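(* Let $X$ be a topological space, let $Y$ be a regular Hausdorff space and let $f : X \to Y$ be globally multi-split continuous. Then the closure of the graph of $f$ in $X \times Y$ (with the product topology) equals the graph of the star multifunction: $\mathrm{cl}(\mathrm{gr}(f)) = \mathrm{gr}(f^* ) \subseteq X \times Y$.
   Context: A neighborhood of a point $p$ (respectively of a subset $S$) in a topological space is a set $V$, not necessarily open, for which there is an open set $U$ with $p \in U \subseteq V$ (respectively $S \subseteq U \subseteq V$). Let $f : X \to Y$ be a function between topological spaces and $p \in X$. The function $f$ is multi-split continuous at $p$ if there exists a finite non-empty set $Z_p \subseteq Y$ such that: (a) for every $y \in Z_p$ and all neighborhoods $U \subseteq X$ of $p$ and $V \subseteq Y$ of $y$ one has $f(U) \cap V \neq \varnothing$; (b) for every neighborhood $V \subseteq Y$ of the set $Z_p$ there exists a neighborhood $U \subseteq X$ of $p$ with $f(U) \subseteq V$. Such a $Z_p$ is called a set of extended values of $f$ at $p$. The function $f$ is globally multi-split continuous if it is multi-split continuous at every $p \in X$. If $Y$ is Hausdorff, the set of extended values of $f$ at $p$ is unique. If $Y$ is Hausdorff and $f : X \to Y$ is globally multi-split continuous, its star multifunction is $f^* : X \rightrightarrows Y$ (a map from $X$ to subsets of $Y$), $p \mapsto Z_p$, where $Z_p$ is the set of extended values of $f$ at $p$. Graphs: $\mathrm{gr}(f) = \{(x, f(x)) : x \in X\}$ and $\mathrm{gr}(f^* ) = \{(x,y) \in X \times Y : y \in f^*(x)\}$. *)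

(* Defs.v *)
From mathcomp Require Import all_boot all_order all_algebra.
From mathcomp Require Import finmap.
From mathcomp Require Import all_classical topology.

Set Implicit Arguments.
Unset Strict Implicit.
Unset Printing Implicit Defensive.

Local Open Scope classical_set_scope.

Section multi_split.
Context {X Y : topologicalType}.
Implicit Types (f : X -> Y) (p : X) (Z : set Y).

(* [nbhs] and [set_nbhs] are systems of not necessarily open neighborhoods;
   [set_nbhsP] describes [set_nbhs Z V] as Z `<=` U `<=` V for some open U. *)
Definition extended_values f p Z : Prop :=
  [/\ finite_set Z,
      Z !=set0,
      (forall y, Z y -> forall (U : set X) (V : set Y),
         nbhs p U -> nbhs y V -> f @` U `&` V !=set0) &
      (forall V : set Y, set_nbhs Z V ->
         exists2 U : set X, nbhs p U & f @` U `<=` V)].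

Definition multi_split_continuous_at f p : Prop :=
  exists Z, extended_values f p Z.

Definition globally_multi_split_continuous f : Prop :=
  forall p, multi_split_continuous_at f p.

(* The default [set0] is irrelevant when f is globally multi-split continuous;
   for Hausdorff Y the chosen set is the only possible one, see [starE]. *)
Definition star f (p : X) : set Y := xget set0 [set Z | extended_values f p Z].

Definition gr f : set (X * Y) := [set (x, f x) | x in [set: X]].

Definition grm (F : X -> set Y) : set (X * Y) := [set xy | F xy.1 xy.2].

Lemma starP f p :
  multi_split_continuous_at f p -> extended_values f p (star f p).
Proof. exact: (@xgetPex _ set0 (extended_values f p)). Qed.

Lemma extended_values_subset f p Z Z' : hausdorff_space Y ->
  extended_values f p Z -> extended_values f p Z' -> Z `<=` Z'.
Proof.
move=> hY [_ _ Za _] [/finite_fsetP[F ->] _ _ Z'b] z Zz /=.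
apply: contrapT => zF.
have /choice[W WP] : forall y, exists W : set Y * set Y,
    y \in F -> [/\ nbhs z W.1, nbhs y W.2 & W.1 `&` W.2 = set0].
  move=> y; have [yF|yF] := boolP (y \in F); last by exists (set0, set0).
  have zy : z != y by apply/eqP => zy; apply: zF; rewrite zy.
  move: hY; rewrite open_hausdorff => /(_ z y zy)[[A B] /= [zA yB] [oA oB AB]].
  exists (A, B) => _; split => /=; last exact/eqP.
    by apply: open_nbhs_nbhs; split => //; exact: set_mem.
  by apply: open_nbhs_nbhs; split => //; exact: set_mem.
have nV : nbhs z (\bigcap_(y in [set` F]) (W y).1).
  by apply: filter_bigI => y yF; have [] := WP y yF.
have nW : set_nbhs [set` F] (\bigcup_(y in [set` F]) (W y).2).
  move=> y /= yF; have [_ yW _] := WP y yF.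
  by apply: filterS yW => t Wt; exists y.
have [U pU fU] := Z'b _ nW.
have [t [/fU[y yF Wt] /(_ y yF) Vt]] := Za _ Zz _ _ pU nV.
have [_ _ W0] := WP y yF.
by have : ((W y).1 `&` (W y).2) t := conj Vt Wt; rewrite W0.
Qed.

Lemma starE f p Z : hausdorff_space Y -> extended_values f p Z -> star f p = Z.
Proof.
move=> hY fZ; have fs : extended_values f p (star f p) by apply: starP; exists Z.
by apply/seteqP; split; [exact: extended_values_subset hY fs fZ
                            |exact: extended_values_subset hY fZ fs].
Qed.

End multi_split.

(* Main.v *)
Require Import Defs.
From mathcomp Require Import all_boot all_order all_algebra.
From mathcomp Require Import all_classical topology.

Local Open Scope classical_set_scope.

(** Write [Z] for the set of extended values of [f] at [x].  The two clauses
    defining [Z] give one inclusion each.  If [y] lies in [Z], then the images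
    of the neighborhoods of [x] meet every neighborhood of [y], so every box
    around [(x, y)] meets the graph.  If [y] does not lie in [Z], then, [Z]
    being finite and hence closed, regularity yields a neighborhood [V] of [y]
    whose closure misses [Z].  The complement of that closure is a neighborhood
    of [Z], so it contains [f @` U] for some neighborhood [U] of [x], and the
    box [U `*` V] then misses the graph. *)

(** Boxes form a neighborhood base of the product, so a closure point of the
    graph is exactly a value [y] that passes the first test for extended
    values of [f] at [x]. *)
Lemma closure_grP {X Y : topologicalType} {f : X -> Y} {x : X} {y : Y} :
  closure (gr f) (x, y) <->
  forall (U : set X) (V : set Y), nbhs x U -> nbhs y V -> f @` U `&` V !=set0.
Proof.
split=> [cl U V xU yV|meet B [[U V] /= [xU yV] UVB]].
  have xyUV : nbhs (x, y) (U `*` V) by exists (U, V).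
  have [_ [[t _ <-] [/= Ut Vft]]] := cl _ xyUV.
  by exists (f t); split=> //; exists t.
have [_ [[t Ut <-] Vft]] := meet U V xU yV.
by exists (t, f t); split; [exists t | exact: UVB].
Qed.

(** Regularity in the form needed to apply the second clause of the definition
    of extended values: the neighborhood of [Z] is disjoint from [V]. *)
Lemma closed_separated {Y : topologicalType} {Z : set Y} {y : Y} :
  regular_space Y -> closed Z -> ~ Z y ->
  exists2 V, nbhs y V & set_nbhs Z (~` closure V).
Proof.
move=> rY cZ nZy.
have [V yV clV] : filter_from (nbhs y) closure (~` Z).
  by apply: rY; apply: open_nbhs_nbhs; split=> //; exact: closed_openC.
exists V => // z Zz; apply: open_nbhs_nbhs; split.
  exact/closed_openC/closed_closure.
by move=> /clV; apply.
Qed.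

Theorem proposition4p7 (X Y : topologicalType) (f : X -> Y)
  (hY : hausdorff_space Y) (rY : regular_space Y)
  (hf : globally_multi_split_continuous f) :
  closure (gr f) = grm (star f).
Proof.
apply/seteqP; split=> -[x y];
  have [finZ _ meetZ contZ] := starP (hf x); last first.
  by move=> /= Zy; apply/closure_grP => U V; exact: meetZ.
move=> /closure_grP meet /=; apply: contrapT => nZy.
have closedZ : closed (star f x).
  exact: (accessible_finite_set_closed.1 (hausdorff_accessible hY)).
have [V yV ZV] := closed_separated rY closedZ nZy.
have [U xU fU] := contZ _ ZV.
have [t [/fU nVt Vt]] := meet U V xU yV.
exact/nVt/subset_closure.
Qed.
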